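(* Let $k\ge 1$ and let $\pi_1,\dots,\pi_k\in\mathbb{R}^n\setminus\{0\}$ satisfy $\pi_i\perp\pi_j$ for all $i\ne j$. For each $i\in[k]$ let $\pi_0^i<\pi_1^i$ be real numbers, and let $$F=\bigcup_{i=1}^k\{(x,t)\in\mathbb{R}^{n+1}:\pi_0^i\le\pi_i^Tx\le\pi_1^i\}.$$ Let $g:\mathbb{R}^n\to\mathbb{R}$ and $f_i:\mathbb{R}\to\mathbb{R}$ ($i\in[k]$) be closed convex functions, let $P_\Pi^\perp=I-\sum_{i=1}^k\frac{\pi_i\pi_i^T}{\|\pi_i\|_2^2}$, and let $$B_{g,f}=\Bigl\{(x,t)\in\mathbb{R}^{n+1}: g(P_\Pi^\perp x)+\sum_{i=1}^kf_i(\pi_i^Tx)\le t\Bigr\}.$$ For $i\in[k]$ let $a_i=\frac{f_i(\pi_1^i)-f_i(\pi_0^i)}{\pi_1^i-\pi_0^i}$ and $b_i=\frac{\pi_1^if_i(\pi_0^i)-\pi_0^if_i(\pi_1^i)}{\pi_1^i-\pi_0^i}$, and for $\mathcal{I}\subseteq[k]$ let $$h_{\mathcal{I}}(x)=g(P_\Pi^\perp x)+\sum_{i\in[k]\setminus\mathcal{I}}f_i(\pi_i^Tx)+\sum_{i\in\mathcal{I}}\bigl(a_i\pi_i^Tx+b_i\bigr).$$ Then $$\mathrm{conv}\bigl(B_{g,f}\setminus \mathrm{int}(F)\bigr)=B_{g,f}\cap C,\qquad C=\Bigl\{(x,t)\in\mathbb{R}^{n+1}:\max_{\mathcal{I}\subseteq[k]}h_{\mathcal{I}}(x)\le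 t\Bigr\}.$$
   Context: $[k]=\{1,\dots,k\}$. $\mathrm{int}$ is the topological interior and $\mathrm{conv}$ the convex hull. *)

(* Defs.v *)
From HB Require Import structures.
From mathcomp Require Import all_boot all_order all_algebra.
From mathcomp Require Import all_classical all_reals all_analysis.

Set Implicit Arguments.
Unset Strict Implicit.
Unset Printing Implicit Defensive.

Import Order.TTheory GRing.Theory Num.Theory.
Import numFieldNormedType.Exports.

Local Open Scope classical_set_scope.
Local Open Scope ring_scope.

Definition convex_hull (R : numDomainType) (M : lmodType R) (A : set M) :
  set M := smallest (@convex_set R M) A.

Definition closed_convex_function (R : realType) (E : normedModType R)
    (f : E -> R) :=
  closed [set z : E * R | f z.1 <= z.2] /\ convex_function setT f.

Definition dot (R : realType) (n : nat) (u v : 'cV[R]_n) : R :=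
  (u^T *m v) 0 0.

(* The Euclidean norm; the library's norm on matrices is the sup norm. *)
Definition norm2 (R : realType) (n : nat) (u : 'cV[R]_n) : R :=
  Num.sqrt (\sum_(j < n) u j 0 ^+ 2).

Section SplitDisjunction.
Context (R : realType) (n k : nat).

(* R^(n+1) is represented as R^n * R, with its product topology and
   componentwise module structure. *)
Local Notation space := ('cV[R]_n * R^o)%type.

Context (dir : 'I_k -> 'cV[R]_n) (lo hi : 'I_k -> R).

Definition split_set : set space :=
  \bigcup_(i in [set: 'I_k])
    [set z | lo i <= dot (dir i) z.1 <= hi i].

Definition proj_orth : 'M[R]_n :=
  1%:M - \sum_(i < k) (norm2 (dir i) ^+ 2)^-1 *: (dir i *m (dir i)^T).

Context (g : 'cV[R]_n -> R) (f : 'I_k -> R -> R).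

Definition epi_sep : set space :=
  [set z | g (proj_orth *m z.1) + \sum_(i < k) f i (dot (dir i) z.1) <= z.2].

Definition chord_slope (i : 'I_k) : R :=
  (f i (hi i) - f i (lo i)) / (hi i - lo i).

Definition chord_icept (i : 'I_k) : R :=
  (hi i * f i (lo i) - lo i * f i (hi i)) / (hi i - lo i).

Definition chord_fun (I : {set 'I_k}) (x : 'cV[R]_n) : R :=
  g (proj_orth *m x) + \sum_(i < k | i \notin I) f i (dot (dir i) x)
  + \sum_(i in I) (chord_slope i * dot (dir i) x + chord_icept i).

(* Seeding the maximum with the value at the empty set, itself one of the
   indices, makes it the maximum over all subsets. *)
Definition chord_set : set space :=
  [set z | \big[Num.max/chord_fun finset.set0 z.1]_(I : {set 'I_k})
             chord_fun I z.1 <= z.2].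

End SplitDisjunction.

(* Main.v *)
Require Import Defs.
From mathcomp Require Import all_boot all_order all_algebra.
From mathcomp Require Import all_classical all_reals all_analysis.
From mathcomp Require Import ring lra.

Import Order.TTheory GRing.Theory Num.Theory.
Import numFieldNormedType.Exports.

Local Open Scope classical_set_scope.
Local Open Scope ring_scope.

(* Write s_i = <dir i, x>, and let l_i be the chord of f_i over [lo i, hi i].
   Maximising over subsets term by term shows that the right-hand side is the
   epigraph of M(x) = g(P x) + \sum_i max(f_i(s_i), l_i(s_i)), which is convex.
   By convexity f_i >= l_i outside (lo i, hi i) and f_i <= l_i on [lo i, hi i],
   so M coincides with g(P x) + \sum_i f_i(s_i) off the interior of the split
   set, which gives one inclusion.  For the other, the directions being
   orthogonal, each s_i can be changed without affecting P x or the other s_j,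
   and M is affine in s_i along [lo i, hi i]: a point of the epigraph is
   therefore split successively along each s_i lying in (lo i, hi i). *)

Section Dot.
Context {R : realType} {n : nat}.
Implicit Types u v : 'cV[R]_n.

Lemma dotE u v : dot u v = \sum_j u j 0 * v j 0.
Proof. by rewrite /dot mxE; apply: eq_bigr => j _; rewrite mxE. Qed.

Lemma dotDr u v w : dot u (v + w) = dot u v + dot u w.
Proof. by rewrite /dot mulmxDr mxE. Qed.

Lemma dotZr u a v : dot u (a *: v) = a * dot u v.
Proof. by rewrite /dot -scalemxAr mxE. Qed.

Lemma dot_sumr u (I : finType) (F : I -> 'cV[R]_n) :
  dot u (\sum_i F i) = \sum_i dot u (F i).
Proof. by rewrite /dot mulmx_sumr summxE. Qed.

Lemma norm2_sqr u : norm2 u ^+ 2 = dot u u.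
Proof.
rewrite /norm2 sqr_sqrtr; last by apply: sumr_ge0 => j _; rewrite sqr_ge0.
by rewrite dotE; apply: eq_bigr => j _; rewrite expr2.
Qed.

Lemma dot_self_gt0 u : u != 0 -> 0 < dot u u.
Proof.
move=> u0; rewrite lt_neqAle dotE sumr_ge0 ?andbT; last first.
  by move=> j _; rewrite -expr2 sqr_ge0.
apply: contra u0; rewrite eq_sym psumr_eq0; last first.
  by move=> j _; rewrite -expr2 sqr_ge0.
move=> /allP u0; apply/eqP/matrixP => i j; rewrite ord1 mxE.
by have := u0 i (mem_index_enum i); rewrite mulf_eq0 orbb => /eqP.
Qed.

Lemma dot_continuous u : continuous (dot u).
Proof.
have -> : dot u = fun v => \sum_j u j 0 * v j 0.
  by apply/funext => v; rewrite dotE.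
apply: continuous_big => [|j _ v]; first exact: add_continuous.
by apply: continuousM; [exact: cst_continuous | exact: coord_continuous].
Qed.

End Dot.

Section RealConvex.
Context {R : realType}.

Lemma convex_function_comb (E : lmodType R) (f : E -> R) :
  convex_function setT f ->
  forall p, 0 <= p <= 1 -> forall x y,
    f (p *: x + (1 - p) *: y) <= p * f x + (1 - p) * f y.
Proof.
move=> cf p /andP[p0 p1] x y.
exact: cf (Itv01 p0 p1) x y (mem_setT x) (mem_setT y).
Qed.

Context (f : R -> R) (cf : convex_function (E := R^o) setT f).

(** Convexity with weight [(z - y) / (z - x)] on [x], cleared of its denominator so that [x = z] is
    allowed. *)
Lemma convex_three_points x y z : x <= y -> y <= z ->
  (z - x) * f y <= (z - y) * f x + (y - x) * f z.
Proof.
move=> xy yz; have [xz|xz] := eqVneq x z.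
  have -> : y = z by lra.
  by rewrite xz; lra.
have zx0 : 0 < z - x by rewrite subr_gt0 lt_neqAle xz (le_trans xy yz).
have p01 : 0 <= (z - y) / (z - x) <= 1.
  by rewrite divr_ge0 ?ler_pdivrMr //= ?mul1r; lra.
have := convex_function_comb _ _ cf _ p01 x z.
set p := (z - y) / (z - x) => h.
have pE : p * (z - x) = z - y by rewrite /p divfK // gt_eqF.
have yE : p *: (x : R^o) + (1 - p) *: (z : R^o) = y.
  rewrite -[_ *: _]/(p * x) -[X in _ + X]/((1 - p) * z).
  have -> : p * x + (1 - p) * z = z - p * (z - x) by ring.
  by rewrite pE; lra.
rewrite yE in h.
have -> : (z - y) * f x + (y - x) * f z =
    (z - x) * (p * f x + (1 - p) * f z).
  have -> : y - x = (z - x) - p * (z - x) by rewrite pE; lra.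
  by rewrite -pE; ring.
by rewrite ler_pM2l.
Qed.

End RealConvex.

Section SplitDisjunction.
Context {R : realType} {n k : nat}.
Context {dir : 'I_k -> 'cV[R]_n} {lo hi : 'I_k -> R}.
Hypothesis dir_neq0 : forall i, dir i != 0.
Hypothesis dir_orth : forall i j, i != j -> dot (dir i) (dir j) = 0.
Hypothesis lt_lo_hi : forall i, lo i < hi i.
Context {g : 'cV[R]_n -> R} {f : 'I_k -> R -> R}.
Local Notation coord i x := (dot (dir i) x).

(** * Interior of the split set *)

Lemma dot_dir_comb i (a : 'I_k -> R) :
  dot (dir i) (\sum_j a j *: dir j) = a i * dot (dir i) (dir i).
Proof.
rewrite dot_sumr (bigD1 i) //= dotZr big1 ?addr0 // => j ji.
by rewrite dotZr dir_orth ?mulr0 // eq_sym.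
Qed.

(* At a point whose coordinates all avoid the open intervals, pushing every
   coordinate outwards along the orthogonal family leaves the closed slabs. *)
Lemma interior_split_setP (z : 'cV[R]_n * R^o) :
  (interior (split_set dir lo hi)) z <->
  exists i, lo i < dot (dir i) z.1 < hi i.
Proof.
split=> [zF | [i zi]].
  apply: contrapT => nz.
  have {}nz i : dot (dir i) z.1 <= lo i \/ hi i <= dot (dir i) z.1.
    apply/orP; rewrite !leNgt -negb_and; apply/negP => h.
    by apply: nz; exists i.
  pose v := \sum_j (if dot (dir j) z.1 <= lo j then -1 else 1) *: dir j.
  have hc : z.1 + e *: v @[e --> (0 : R)] --> z.1.
    rewrite [X in _ --> X](_ : z.1 = z.1 + (0 : R) *: v); last first.
      by rewrite scale0r addr0.
    by apply: cvgD; [exact: cvg_cst | exact: scalel_continuous].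
  pose h (e : R) : 'cV[R]_n * R^o := (z.1 + e *: v, z.2).
  have {}hc : h e @[e --> (0 : R)] --> z.
    by rewrite [z in _ --> z]surjective_pairing; apply: cvg_pair hc (cvg_cst _).
  (* If [z] were interior, a small step with [e > 0] would stay in the split set; half the radius is
     such a step. *)
  have /nbhs_ballP[d /= d0 hd] := hc _ zF.
  have [i _ /= /andP[l u]] : split_set dir lo hi (h (d / 2)).
    by apply: hd; rewrite /ball /= sub0r normrN gtr0_norm; lra.
  move: l u; rewrite dotDr dotZr dot_dir_comb.
  have p : 0 < d / 2 * dot (dir i) (dir i).
    by rewrite mulr_gt0 ?dot_self_gt0 // divr_gt0.
  case: ifP => [le|]; first by lra.
  by case: (nz i) => [-> //|]; lra.
(* Conversely, by continuity the open slab of [i] is a neighbourhood of [z], and it lies in the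
   split set. *)
have c : dot (dir i) w.1 @[w --> z] --> dot (dir i) z.1.
  by apply: cvg_comp; [exact: cvg_fst | exact: dot_continuous].
have o : \forall s \near dot (dir i) z.1, s \in `]lo i, hi i[.
  by apply: near_in_itvoo; rewrite in_itv.
apply: (@filterS _ (nbhs z) _ _ (split_set dir lo hi) _ (c _ o)) => w /=.
rewrite in_itv /= => /andP[lw wh]; by exists i => //=; rewrite !ltW.
Qed.

(** * Chords and the convex majorant *)

Definition chord i s := chord_slope lo hi f i * s + chord_icept lo hi f i.

Definition majorant x :=
  g (proj_orth dir *m x)
  + \sum_i Num.max (f i (coord i x)) (chord i (coord i x)).

(** The interpolation form of the chord, shaped to match [convex_three_points]. *)
Lemma chordE i s :
  (hi i - lo i) * chord i s = (hi i - s) * f i (lo i) + (s - lo i) * f i (hi i).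
Proof.
have := lt_lo_hi i; rewrite /chord /chord_slope /chord_icept => ?.
by field; lra.
Qed.

Lemma chord_lo i : chord i (lo i) = f i (lo i).
Proof.
have := lt_lo_hi i; rewrite /chord /chord_slope /chord_icept => ?.
by field; lra.
Qed.

Lemma chord_hi i : chord i (hi i) = f i (hi i).
Proof.
have := lt_lo_hi i; rewrite /chord /chord_slope /chord_icept => ?.
by field; lra.
Qed.

Hypothesis g_convex : convex_function setT g.
Hypothesis f_convex : forall i, convex_function (E := R^o) setT (f i).

Lemma chord_ge i s : lo i <= s <= hi i -> f i s <= chord i s.
Proof.
move=> /andP[ls sh]; have lh := lt_lo_hi i.
rewrite -(@ler_pM2l _ (hi i - lo i)) ?subr_gt0 // chordE.
exact: convex_three_points.
Qed.

(** The endpoint nearer to [s] lies between [s] and the other endpoint; the three-point inequality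
    at that middle point rearranges to the claim. *)
Lemma chord_le i s : s <= lo i \/ hi i <= s -> chord i s <= f i s.
Proof.
move=> out; have lh := lt_lo_hi i.
rewrite -(@ler_pM2l _ (hi i - lo i)) ?subr_gt0 // chordE.
case: out => out.
  by have := convex_three_points _ (f_convex i) _ _ _ out (ltW lh); lra.
by have := convex_three_points _ (f_convex i) _ _ _ (ltW lh) out; lra.
Qed.

Lemma max_convex i p s t : 0 <= p <= 1 ->
  Num.max (f i (p * s + (1 - p) * t)) (chord i (p * s + (1 - p) * t)) <=
  p * Num.max (f i s) (chord i s) + (1 - p) * Num.max (f i t) (chord i t).
Proof.
move=> p01; have [p0 p1] := andP p01.
have q0 : 0 <= 1 - p by rewrite subr_ge0.
rewrite ge_max; apply/andP; split.
  apply: le_trans (convex_function_comb _ _ (f_convex i) _ p01 s t) _.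
  by apply: lerD; rewrite ler_wpM2l // le_max lexx.
have -> : chord i (p * s + (1 - p) * t) = p * chord i s + (1 - p) * chord i t.
  by rewrite /chord; ring.
by apply: lerD; rewrite ler_wpM2l // le_max lexx orbT.
Qed.

Lemma majorant_convex p x y : 0 <= p <= 1 ->
  majorant (p *: x + (1 - p) *: y) <= p * majorant x + (1 - p) * majorant y.
Proof.
move=> p01; rewrite /majorant !mulrDr addrACA; apply: lerD.
  rewrite mulmxDr -!scalemxAr; exact: convex_function_comb g_convex _ _ _ _.
rewrite !mulr_sumr -big_split /=; apply: ler_sum => i _.
by rewrite dotDr !dotZr max_convex.
Qed.

Lemma convex_epi_majorant :
  convex_set ([set z | majorant z.1 <= z.2] : set ('cV[R]_n * R^o)).
Proof.
move=> x y p; rewrite !inE /= => Mx My.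
have p01 : 0 <= p%:num <= 1 by rewrite ge0 le1.
apply: le_trans (majorant_convex _ x.1 y.1 p01) _.
by apply: lerD; apply: ler_wpM2l; rewrite ?subr_ge0.
Qed.

Lemma chord_funE (I : {set 'I_k}) x :
  chord_fun dir lo hi g f I x = g (proj_orth dir *m x) +
  \sum_i (if i \in I then chord i (coord i x) else f i (coord i x)).
Proof.
rewrite /chord_fun -addrA; congr (_ + _).
rewrite [in RHS](bigID (mem I)) /= [RHS]addrC.
by congr (_ + _); apply: eq_bigr => i; [move=> /negbTE -> | move=> ->].
Qed.

Lemma epi_sep_chord_setE :
  epi_sep dir g f `&` chord_set dir lo hi g f = [set z | majorant z.1 <= z.2].
Proof.
apply/seteqP; split => z /=.
  (* The maximising subset: it takes the chord exactly where the chord dominates, so [chord_fun] at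
     [I] reaches [majorant]. *)
  pose I := [set i | f i (coord i z.1) <= chord i (coord i z.1)]%SET.
  move=> [_ /bigmax_leP[_ /(_ I isT)]].
  apply: le_trans; rewrite chord_funE; apply: lerD => //; apply: ler_sum => i _.
  by rewrite inE; case: (leP (f i _) _).
move=> le; have leI I : chord_fun dir lo hi g f I z.1 <= z.2.
  apply: (le_trans _ le); rewrite chord_funE; apply: lerD => //.
  apply: ler_sum => i _.
  by case: ifP => _; rewrite le_max lexx ?orbT.
split; last by apply/bigmax_leP; split.
(* For the empty subset, [chord_fun] is the function whose epigraph is [epi_sep]. *)
have := leI finset.set0; rewrite chord_funE.
by under eq_bigr do rewrite finset.in_set0.
Qed.

Lemma majorant_outside x :
  (forall i, coord i x <= lo i \/ hi i <= coord i x) ->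
  majorant x = g (proj_orth dir *m x) + \sum_i f i (coord i x).
Proof.
move=> out; congr (_ + _); apply: eq_bigr => i _.
by apply/max_idPl/chord_le.
Qed.

(** * Moving one coordinate at a time *)

Lemma proj_orth_dir i : proj_orth dir *m dir i = 0.
Proof.
rewrite /proj_orth mulmxBl mul1mx mulmx_suml (bigD1 i) //= big1 => [|j ji].
  rewrite addr0 norm2_sqr -scalemxAl -mulmxA.
  have -> : (dir i)^T *m dir i = (dot (dir i) (dir i))%:M.
    by rewrite [LHS]mx11_scalar.
  by rewrite mul_mx_scalar scalerA mulVf ?scale1r ?subrr // gt_eqF ?dot_self_gt0.
rewrite -scalemxAl -mulmxA.
have -> : (dir j)^T *m dir i = (dot (dir j) (dir i))%:M by rewrite [LHS]mx11_scalar.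
by rewrite dir_orth // mul_mx_scalar scale0r scaler0.
Qed.

(** The point where the line through [x] along [dir i] meets the hyperplane [coord i = c]. *)
Definition reset i c x := x + ((c - coord i x) / dot (dir i) (dir i)) *: dir i.

Lemma coord_reset i c x j : coord j (reset i c x) = if j == i then c else coord j x.
Proof.
rewrite /reset dotDr dotZr; case: eqVneq => [->|ji].
  by rewrite divfK ?gt_eqF ?dot_self_gt0 // addrC subrK.
by rewrite (dir_orth _ _ ji) mulr0 addr0.
Qed.

(** Moving along [dir i] fixes the projection and all other coordinates, so only the summand of [i]
    changes. *)
Lemma majorant_reset i c x :
  majorant (reset i c x) = majorant x
    - Num.max (f i (coord i x)) (chord i (coord i x))
    + Num.max (f i c) (chord i c).
Proof.
rewrite /majorant mulmxDr -scalemxAr proj_orth_dir scaler0 addr0.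
rewrite (bigD1 i) //= [in RHS](bigD1 i) //= coord_reset eqxx.
under eq_bigr => j ji do rewrite coord_reset (negbTE ji).
ring.
Qed.

(* Induction on the number of coordinates inside their open interval. *)
Lemma epi_majorant_sub_convex (A : set ('cV[R]_n * R^o)) : convex_set A ->
  epi_sep dir g f `\` interior (split_set dir lo hi) `<=` A ->
  [set z | majorant z.1 <= z.2] `<=` A.
Proof.
move=> cA sA z /=.
have [m] := ubnP #|[set i | lo i < coord i z.1 < hi i]%SET|.
elim: m z => // m IH z; rewrite ltnS => cz Mz.
(* With no coordinate inside, the point is off the interior and [majorant] agrees with the function
   defining [epi_sep]. *)
have [noin | [i]] := set_0Vmem [set i | lo i < coord i z.1 < hi i]%SET.
  have out i : ~~ (lo i < coord i z.1 < hi i).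
    by apply/negP => h; have := finset.in_set0 i; rewrite -noin inE h.
  apply: sA; split; last first.
    by rewrite interior_split_setP => -[i]; apply/negP/out.
  move: Mz; rewrite majorant_outside // => i.
  by apply/orP; rewrite !leNgt -negb_and.
rewrite inE => zi; have [li his] := andP zi; have lh := lt_lo_hi i.
(* The height is shifted by exactly the change in [majorant], so both endpoint versions stay in its
   epigraph, with one coordinate fewer inside. *)
have Ac c : c = lo i \/ c = hi i ->
    A (reset i c z.1, z.2 - chord i (coord i z.1) + f i c).
  move=> cE; apply: IH => /=.
    apply: leq_trans cz; apply: proper_card; apply/properP; split.
      apply/fintype.subsetP => j; rewrite !inE coord_reset.
      by case: eqVneq => [->|//]; case: cE => ->; rewrite ltxx ?andbF.
    exists i; rewrite !inE // coord_reset eqxx.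
    by case: cE => ->; rewrite ltxx ?andbF.
  rewrite majorant_reset.
  have /max_idPr -> : f i (coord i z.1) <= chord i (coord i z.1).
    by apply: chord_ge; rewrite !ltW.
  have -> : chord i c = f i c by case: cE => ->; rewrite ?chord_lo ?chord_hi.
  by rewrite maxxx lerD2r lerD2r.
(* The weight for which the coordinate is [p * lo i + (1 - p) * hi i]; the two displacements along
   [dir i] then cancel. *)
pose p := (hi i - coord i z.1) / (hi i - lo i).
have lh0 : hi i - lo i != 0 by rewrite subr_eq0 gt_eqF.
have p0 : 0 <= p by rewrite divr_ge0; lra.
have p1 : p <= 1 by rewrite ler_pdivrMr ?mul1r; lra.
have := cA _ _ (Itv01 p0 p1) (mem_set (Ac _ (or_introl erefl)))
  (mem_set (Ac _ (or_intror erefl))).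
rewrite inE; congr A; apply: injective_projections => /=.
  rewrite /unstable.onem /reset !scalerDr !scalerA addrACA -!scalerDl.
  rewrite subrKC scale1r -[RHS]addr0; congr (_ + _).
  apply/eqP; rewrite scaler_eq0; apply/orP; left; apply/eqP.
  by rewrite /p; field; rewrite lh0 gt_eqF ?dot_self_gt0.
rewrite /unstable.onem.
(* The chord being affine, the two height shifts average to zero. *)
have -> : chord i (coord i z.1) = p * f i (lo i) + (1 - p) * f i (hi i).
  by apply: (mulfI lh0); rewrite chordE /p; field.
rewrite -[_ *: _]/(p * _) -[X in _ + X]/((1 - p) * _).
by ring.
Qed.

End SplitDisjunction.

Theorem proposition3p7 (R : realType) (n k : nat) (hk : (1 <= k)%N)
    (dir : 'I_k -> 'cV[R]_n)
    (dir_neq0 : forall i, dir i != 0)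
    (dir_orth : forall i j, i != j -> dot (dir i) (dir j) = 0)
    (lo hi : 'I_k -> R) (lt_lo_hi : forall i, lo i < hi i)
    (g : 'cV[R]_n -> R) (f : 'I_k -> R -> R)
    (g_cc : closed_convex_function (E := 'cV[R]_n) g)
    (f_cc : forall i, closed_convex_function (E := R^o) (f i)) :
  convex_hull (epi_sep dir g f `\` interior (split_set dir lo hi)) =
  epi_sep dir g f `&` chord_set dir lo hi g f.
Proof.
have g_convex : convex_function setT g by case: g_cc.
have f_convex i : convex_function (E := R^o) setT (f i) by case: (f_cc i).
rewrite epi_sep_chord_setE //; apply/seteqP; split; last first.
  move=> z Mz A [cA sA]; exact: epi_majorant_sub_convex Mz.
(* By minimality of the hull, it remains to place the generating points in the convex epigraph of
   [majorant]. *)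
apply: smallest_sub => [|z [Bz nFz]]; first exact: convex_epi_majorant.
rewrite /= majorant_outside // => i; apply/orP.
rewrite !leNgt -negb_and; apply/negP => zi; apply: nFz.
by apply/interior_split_setP => //; exists i.
Qed.
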